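(* Consider an ensemble of $K$ decision trees on $\mathbb{R}^d$ with real leaf values, an input $x\in\mathbb{R}^d$ and $\epsilon\ge0$. Let $G$ be the associated $K$-partite leaf graph with parts $V_1,\dots,V_K$, and let $v^*$ be the maximum of $\sum_{i\in C}v_i$ over all $K$-cliques $C$ of $G$. Let $T\ge 2$ and $0\le L\le\lceil\log_T K\rceil$ be integers, let $N=\lceil K/T^L\rceil$, and let $V'_1,\dots,V'_N$ be the level-$L$ parts of pseudo nodes, with pseudo prediction values $v_A$. Then both of the following quantities are upper bounds of $v^*$: $$\text{(i)}\quad \sum_{k=1}^{N}\max_{A\in V'_k}v_A\ \ge\ v^*,\qquad\qquad \text{(ii)}\quad \max_{A\in V'_N}d_A\ \ge\ v^*,$$ where $d_A=v_A$ for $A\in V'_1$ and, for $k\ge2$ and $A\in V'_k$, $d_A=v_A+\max\{d_{A'}:A'\in V'_{k-1},\ A'\text{ and }A\text{ adjacent}\}$ (with the maximum over the empty set equal to $-\infty$). Moreover, if $N=1$, both quantities are equal to $v^*$.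
   Context: A decision tree on $\mathbb{R}^d$ is a finite rooted binary tree in which each internal node $i$ has a left child, a right child and a feature-threshold pair $(t_i,\eta_i)\in\{1,\dots,d\}\times\mathbb{R}$. An input $x\in\mathbb{R}^d$ starts at the root and at internal node $i$ goes to the left child if $x_{t_i}\le\eta_i$ and to the right child otherwise, until it reaches a leaf. Each leaf $i$ carries a real prediction value $v_i$. For each node $i$ the box $B^i=(l^i_1,r^i_1]\times\dots\times(l^i_d,r^i_d]$ is defined recursively: the root's box is all of $\mathbb{R}^d$. If $p$ and $q$ are the left and right children of $i$, their boxes agree with $B^i$ in every coordinate $t\ne t_i$, and in coordinate $t_i$ the interval of $p$ is $(l^i_{t_i},\min\{r^i_{t_i},\eta_i\}]$ and the interval of $q$ is $(\max\{l^i_{t_i},\eta_i\},r^i_{t_i}]$ (an interval $(l,r]$ with $l\ge r$ is empty, and $(l,\infty]$ means $(l,\infty)$). $\mathrm{Ball}(x,\epsilon)=\{x'\in\mathbb{R}^d:\|x'-x\|_\infty\le\epsilon\}$. The leaf graph $G$ has as vertices the leaves $i$ of all trees (leaves of different trees regarded as distinct) with $B^i\cap\mathrm{Ball}(x,\epsilon)\ne\emptyset$, with distinct vertices $i,j$ adjacent iff $B^i\cap B^j\ne\emptyset$; $V_k$ is the set of vertices of $G$ that are leaves of tree $k$. A $K$-clique is a set of $K$ distinct pairwise adjacent vertices. Multi-level construction. At level $0$, $U^{(0)}_k=\{(\{i\},B^i):i\in V_k\}$ for $k=1,\dots,K$. At level $l\ge1$, the $\lceil K/T^{l-1}\rceil$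 sets of level $l-1$ are grouped consecutively into $\lceil K/T^l\rceil$ groups of $T$ sets (the last group may contain fewer), and for each $k=1,\dots,\lceil K/T^l\rceil$ the set $U^{(l)}_k$ is obtained by enumerating cliques in the $k$-th group $U^{(l-1)}_{(k-1)T+1},\dots,U^{(l-1)}_{kT}$ (those that exist) as follows: start with the first set of the group; successively for each next set $U$ of the group, replace the current set $\hat U$ by $\{(A\cup\hat A,\,B\cap\hat B):(\hat A,\hat B)\in\hat U,\ (A,B)\in U,\ B\cap\hat B\neq\emptyset\}$. The final set is $U^{(l)}_k$. The level-$L$ pseudo nodes of part $k$ are $V'_k=\{A:(A,B)\in U^{(L)}_k\}$, the pseudo prediction value of $A$ is $v_A=\sum_{i\in A}v_i$, and two pseudo nodes $A,A'$ in different parts are adjacent iff their boxes $B,B'$ (with $(A,B)$, $(A',B')$ in the corresponding sets $U^{(L)}$) satisfy $B\cap B'\neq\emptyset$. *)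

(* Defs.v *)
From HB Require Import structures.
From mathcomp Require Import all_boot all_order all_algebra finmap.
From mathcomp Require Import all_classical all_reals all_analysis.

Set Implicit Arguments.
Unset Strict Implicit.
Unset Printing Implicit Defensive.

Import Order.TTheory GRing.Theory Num.Theory.
Import numFieldNormedType.Exports.

Local Open Scope fset_scope.
Local Open Scope classical_set_scope.
Local Open Scope ring_scope.
Local Open Scope ereal_scope.

(* [DNode t eta p q]: go to the left child [p] if [x_t <= eta], to the right
   child [q] otherwise. *)
Inductive dtree (R : Type) (d : nat) : Type :=
| DLeaf of R
| DNode of 'I_d & R & dtree R d & dtree R d.

Fixpoint leaf (R : Type) (d : nat) (t : dtree R d) : finType :=
  match t with
  | DLeaf _ => unit
  | DNode _ _ p q => (leaf p + leaf q)%type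
  end.

Fixpoint leaf_val (R : Type) (d : nat) (t : dtree R d) : leaf t -> R :=
  match t return leaf t -> R with
  | DLeaf v => fun=> v
  | DNode _ _ p q => fun i =>
      match i with inl j => leaf_val j | inr j => leaf_val j end
  end.

(* A box is the family of the endpoints [(l_t, r_t)] of its coordinate
   intervals [(l_t, r_t]]. *)
Definition box (R : realType) (d : nat) := 'I_d -> \bar R * \bar R.

Definition box_set (R : realType) (d : nat) (b : box R d) : set 'rV[R]_d :=
  [set y | forall t : 'I_d, (b t).1 < (y ord0 t)%:E <= (b t).2].

Definition root_box (R : realType) (d : nat) : box R d := fun=> (-oo, +oo).

Definition left_box (R : realType) (d : nat) (b : box R d) (t : 'I_d)
    (eta : R) : box R d :=
  fun s => if s == t then ((b s).1, mine (b s).2 eta%:E) else b s.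

Definition right_box (R : realType) (d : nat) (b : box R d) (t : 'I_d)
    (eta : R) : box R d :=
  fun s => if s == t then (maxe (b s).1 eta%:E, (b s).2) else b s.

(* [b] is the box of the root of [t]. *)
Fixpoint leaf_box (R : realType) (d : nat) (t : dtree R d) (b : box R d) :
    leaf t -> box R d :=
  match t return leaf t -> box R d with
  | DLeaf _ => fun=> b
  | DNode s eta p q => fun i =>
      match i with
      | inl j => leaf_box (left_box b s eta) j
      | inr j => leaf_box (right_box b s eta) j
      end
  end.

(* The norm on ['rV[R]_d] is the sup norm. *)
Definition Ball (R : realType) (d : nat) (x : 'rV[R]_d) (eps : R) :
    set 'rV[R]_d :=
  [set x' | (`|x' - x| <= eps)%R].

Definition ensemble (R : realType) (d K : nat) := 'I_K -> dtree R d.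

Definition eleaf (R : realType) (d K : nat) (tr : ensemble R d K) : finType :=
  {k : 'I_K & leaf (tr k)}.

Definition evalue (R : realType) (d K : nat) (tr : ensemble R d K)
    (i : eleaf tr) : R :=
  leaf_val (tagged i).

Definition ebox (R : realType) (d K : nat) (tr : ensemble R d K)
    (i : eleaf tr) : set 'rV[R]_d :=
  box_set (leaf_box (@root_box R d) (tagged i)).

Definition vertices (R : realType) (d K : nat) (tr : ensemble R d K)
    (x : 'rV[R]_d) (eps : R) : {set eleaf tr} :=
  [set i : eleaf tr | ebox i `&` Ball x eps != set0]%SET.

Definition adj (R : realType) (d K : nat) (tr : ensemble R d K) :
    rel (eleaf tr) :=
  fun i j => (i != j) && (ebox i `&` ebox j != set0).

Definition Vpart (R : realType) (d K : nat) (tr : ensemble R d K)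
    (x : 'rV[R]_d) (eps : R) (k : 'I_K) : {set eleaf tr} :=
  [set i in vertices tr x eps | tag i == k]%SET.

Definition is_Kclique (R : realType) (d K : nat) (tr : ensemble R d K)
    (x : 'rV[R]_d) (eps : R) (C : {set eleaf tr}) : bool :=
  [&& C \subset vertices tr x eps, #|C| == K &
      [forall i in C, forall j in C, (i != j) ==> adj i j]].

Definition vsum (R : realType) (d K : nat) (tr : ensemble R d K)
    (A : {set eleaf tr}) : R :=
  (\sum_(i in A) evalue i)%R.

(* Maxima are taken in [\bar R], with [-oo] for the empty set. *)
Definition vstar (R : realType) (d K : nat) (tr : ensemble R d K)
    (x : 'rV[R]_d) (eps : R) : \bar R :=
  \big[maxe/-oo]_(C : {set eleaf tr} | is_Kclique x eps C) (vsum C)%:E.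

(* [cdivn m n] is the ceiling of [m / n]. *)
Definition cdivn (m n : nat) : nat := (m %/ n + ~~ (n %| m))%N.

Definition pseudo (R : realType) (d K : nat) (tr : ensemble R d K) :=
  {fset {set eleaf tr} * set 'rV[R]_d}.

Definition merge_parts (R : realType) (d K : nat) (tr : ensemble R d K)
    (Uh U : pseudo tr) : pseudo tr :=
  [fset (q.1 :|: p.1, q.2 `&` p.2) | p in Uh, q in U & q.2 `&` p.2 != set0].

Definition enum_group (R : realType) (d K : nat) (tr : ensemble R d K)
    (s : seq (pseudo tr)) : pseudo tr :=
  if s is U :: s' then foldl (@merge_parts R d K tr) U s' else fset0.

(* Parts are numbered from 0, so the [k]-th group of [T] consecutive sets
   starts at index [k * T]; the last group is truncated by [take]. *)
Fixpoint level (R : realType) (d K : nat) (tr : ensemble R d K)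
    (x : 'rV[R]_d) (eps : R) (T l : nat) : seq (pseudo tr) :=
  match l with
  | 0 => [seq [fset ([set i]%SET, ebox i) | i in Vpart tr x eps k]
         | k <- enum 'I_K]
  | l'.+1 => let s := level tr x eps T l' in
      [seq enum_group (take T (drop (k * T)%N s)) | k <- iota 0 (cdivn K (T ^ l)%N)]
  end.

Definition Upart (R : realType) (d K : nat) (tr : ensemble R d K)
    (x : 'rV[R]_d) (eps : R) (T L k : nat) : pseudo tr :=
  nth fset0 (level tr x eps T L) k.

Definition Vpseudo (R : realType) (d K : nat) (tr : ensemble R d K)
    (x : 'rV[R]_d) (eps : R) (T L k : nat) : {fset {set eleaf tr}} :=
  [fset u.1 | u in Upart tr x eps T L k].

Definition padj (R : realType) (d K : nat) (tr : ensemble R d K)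
    (x : 'rV[R]_d) (eps : R) (T L k k' : nat) (A A' : {set eleaf tr}) : bool :=
  `[< exists B B' : set 'rV[R]_d,
        [/\ (A, B) \in Upart tr x eps T L k,
            (A', B') \in Upart tr x eps T L k' &
            B `&` B' != set0] >].

Fixpoint dval (R : realType) (d K : nat) (tr : ensemble R d K)
    (x : 'rV[R]_d) (eps : R) (T L k : nat) (A : {set eleaf tr}) : \bar R :=
  match k with
  | 0 => (vsum A)%:E
  | k'.+1 => (vsum A)%:E +
      \big[maxe/-oo]_(A' <- Vpseudo tr x eps T L k' |
                      padj x eps T L k' k A' A) dval x eps T L k' A'
  end.

Definition bound_sum (R : realType) (d K : nat) (tr : ensemble R d K)
    (x : 'rV[R]_d) (eps : R) (T L : nat) : \bar R :=
  \sum_(k < cdivn K (T ^ L)%N)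
    \big[maxe/-oo]_(A <- Vpseudo tr x eps T L k) (vsum A)%:E.

Definition bound_dp (R : realType) (d K : nat) (tr : ensemble R d K)
    (x : 'rV[R]_d) (eps : R) (T L : nat) : \bar R :=
  \big[maxe/-oo]_(A <- Vpseudo tr x eps T L (cdivn K (T ^ L)%N).-1)
    dval x eps T L (cdivn K (T ^ L)%N).-1 A.

(* Main.v *)
(** Distinct leaves of one tree have disjoint boxes and pairwise intersecting
boxes have a common point, so a K-clique is the same thing as a choice of one
vertex in each tree whose boxes have a common point.  By induction on the level,
the pairs [(A, B)] of a part are exactly the choices [A] of one vertex in each
tree of an interval of consecutive trees whose common box [B] is nonempty, and
the intervals of the successive parts partition the trees.  A K-clique is thus
cut into one pseudo node per part; consecutive pieces are adjacent and the
values add up, which bounds both maxima from below.  If there is only one part,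
its pseudo nodes are the K-cliques. *)

Require Import Defs.
From mathcomp Require Import all_boot all_order all_algebra finmap.
From mathcomp Require Import all_classical all_reals all_analysis.
From mathcomp Require Import zify.

Set Implicit Arguments.
Unset Strict Implicit.
Unset Printing Implicit Defensive.

Import Order.TTheory GRing.Theory Num.Theory.

Local Open Scope classical_set_scope.
Local Open Scope ring_scope.

(** * Boxes of leaves and their intersections *)

Section Boxes.
Variables (R : realType) (d : nat).
Implicit Types (b : box R d) (y : 'rV[R]_d).

Lemma left_boxP b s eta y :
  box_set (left_box b s eta) y -> box_set b y /\ y ord0 s <= eta.
Proof.
move=> yb; split=> [t|]; last first.
  have := yb s; rewrite /left_box eqxx /= le_min => /andP[_ /andP[_]].
  by rewrite lee_fin.
have := yb t; rewrite /left_box; case: eqP => // _ /=.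
by rewrite le_min => /andP[-> /andP[-> _]].
Qed.

Lemma right_boxP b s eta y :
  box_set (right_box b s eta) y -> box_set b y /\ eta < y ord0 s.
Proof.
move=> yb; split=> [t|]; last first.
  have := yb s; rewrite /right_box eqxx /= gt_max => /andP[/andP[_]].
  by rewrite lte_fin.
have := yb t; rewrite /right_box; case: eqP => // _ /=.
by rewrite gt_max => /andP[/andP[-> _] ->].
Qed.

Lemma leaf_box_sub (t : dtree R d) b (i : leaf t) :
  box_set (leaf_box b i) `<=` box_set b.
Proof.
elim: t b i => [v b []|s eta p IHp q IHq b [i|i] y] //=.
  by move/IHp/left_boxP => [].
by move/IHq/right_boxP => [].
Qed.

(** At the node where two leaves part ways, one box forces [y ord0 s <= eta] and the other
    [eta < y ord0 s]. *)
Lemma leaf_box_inj (t : dtree R d) b (i j : leaf t) y :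
  box_set (leaf_box b i) y -> box_set (leaf_box b j) y -> i = j.
Proof.
elim: t b i j => [v b [] []|s eta p IHp q IHq b] //= [i|i] [j|j].
- by move=> yi yj; rewrite (IHp _ _ _ yi yj).
- move=> /leaf_box_sub/left_boxP[_ le_y] /leaf_box_sub/right_boxP[_].
  by rewrite ltNge le_y.
- move=> /leaf_box_sub/right_boxP[_ lt_y] /leaf_box_sub/left_boxP[_].
  by rewrite leNgt lt_y.
- by move=> yi yj; rewrite (IHq _ _ _ yi yj).
Qed.

(** Intervals are closed on the right, so a finite [r] is its own witness; only [r = +oo] requires a
    choice above [l]. *)
Lemma ereal_interval_nonempty (l r : \bar R) :
  (l < r)%E -> exists y : R, (l < y%:E <= r)%E.
Proof.
case: r => [r||] lr; first by exists r; rewrite lr lexx.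
- case: l lr => [l||] // _.
  + by exists (l + 1); rewrite leey lte_fin ltrDl ltr01.
  + by exists 0; rewrite leey ltNyr.
- by rewrite ltNge leNye in lr.
Qed.

(* In each coordinate, pairwise intersection puts every left endpoint strictly
   below every right endpoint. *)
Lemma box_helly (I : finType) (A : {set I}) (b : I -> box R d) :
    (forall i j, i \in A -> j \in A -> box_set (b i) `&` box_set (b j) !=set0) ->
  exists y, forall i, i \in A -> box_set (b i) y.
Proof.
move=> meet_b.
have coord t : exists z : R, forall i, i \in A -> ((b i t).1 < z%:E <= (b i t).2)%E.
  (* The coordinate intervals intersect in [(l, r]]; the defaults [-oo] and [+oo] also cover an
     empty family. *)
  pose l := \big[maxe/-oo%E]_(i in A) (b i t).1.
  pose r := \big[mine/+oo%E]_(i in A) (b i t).2.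
  have lt_lr : (l < r)%E.
    (* Comparisons with a default use that each box meets itself, hence is nonempty. *)
    apply: bigmax_lt => [|i iA]; apply: lt_bigmin => //.
    - move=> j jA; have [y [/(_ t)/andP[yl yr] _]] := meet_b _ _ jA jA.
      by rewrite (le_lt_trans (leNye _) (lt_le_trans yl yr)).
    - have [y [/(_ t)/andP[yl yr] _]] := meet_b _ _ iA iA.
      by rewrite (lt_le_trans yl (leey _)).
    - move=> j jA; have [y [/(_ t)/andP[yl _] /(_ t)/andP[_ yr]]] := meet_b _ _ iA jA.
      exact: lt_le_trans yl yr.
  have [z /andP[lz zr]] := ereal_interval_nonempty lt_lr.
  exists z => i iA; apply/andP; split.
    by apply: le_lt_trans lz; exact: le_bigmax_cond.
  by apply: le_trans zr _; exact: bigmin_le_cond.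
have [z zP] := choice coord.
by exists (\row_t z t) => i iA t; rewrite mxE; exact: zP.
Qed.

End Boxes.

(** The adjunction characterizing the ceiling: block [k] of length [n] exists exactly when its first
    element does. *)
Lemma ltn_cdivn (m n k : nat) : (0 < n)%N -> (k < cdivn m n)%N = (k * n < m)%N.
Proof.
move=> n_gt0; rewrite /cdivn /dvdn.
have := divn_eq m n; have := ltn_pmod m n_gt0.
set q := (m %/ n)%N; set r := (m %% n)%N => lt_rn ->.
by case: (eqVneq r 0%N) => [->|r0] /=; apply/idP/idP; nia.
Qed.

(** * Choices of one vertex per tree in an interval of trees *)

Section Ensemble.
Variables (R : realType) (d K : nat) (tr : ensemble R d K).
Variables (x : 'rV[R]_d) (eps : R).
Implicit Types (A C : {set eleaf tr}) (U : pseudo tr).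

Definition common_box A : set 'rV[R]_d := [set y | forall i, i \in A -> ebox i y].

Lemma common_boxU A C : common_box (A :|: C) = common_box A `&` common_box C.
Proof.
apply/seteqP; split=> [y yAC|y [yA yC] i].
  by split=> i iA; apply: yAC; rewrite inE iA ?orbT.
by rewrite inE => /orP[/yA|/yC].
Qed.

Lemma common_boxS A C : A \subset C -> common_box C `<=` common_box A.
Proof. by move=> /fintype.subsetP AC y yC i /AC; exact: yC. Qed.

Lemma common_box1 (i : eleaf tr) : common_box [set i]%SET = ebox i.
Proof.
apply/seteqP; split=> [y|y yi j]; first by apply; rewrite inE.
by rewrite inE => /eqP ->.
Qed.

(* [A] picks one vertex in each tree of index in [[a, b)] and no other vertex. *)
Definition section_of (a b : nat) A :=
  A \subset vertices tr x eps /\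
  forall j : 'I_K, #|[set i in A | tag i == j]| = (a <= j < b)%N.

Definition between A (a b : nat) : {set eleaf tr} :=
  [set i in A | (a <= tag i < b)%N].

Lemma between_sub A a b : between A a b \subset A.
Proof. by apply/fintype.subsetP => i; rewrite inE => /andP[]. Qed.

Lemma betweenT A : between A 0 K = A.
Proof. by apply/setP => i; rewrite inE /= ltn_ord andbT. Qed.

Lemma between_cat A a b c :
  (a <= b <= c)%N -> between A a b :|: between A b c = between A a c.
Proof. by move=> abc; apply/setP => i; rewrite !inE; case: (i \in A) => //=; lia. Qed.

Lemma between_disjoint A (a b c : nat) : [disjoint between A a b & between A b c]%B.
Proof.
rewrite -setI_eq0; apply/eqP/setP => i; rewrite !inE.
by case: (i \in A) => //=; lia.
Qed.

Lemma vsum_between A a b c : (a <= b <= c)%N ->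
  vsum (between A a c) = vsum (between A a b) + vsum (between A b c).
Proof.
move=> abc; rewrite -(between_cat A abc) /vsum.
rewrite -bigU ?between_disjoint //.
by apply: eq_bigl => i; rewrite !inE.
Qed.

Lemma section_between a b a' b' A : section_of a b A ->
  (a <= a')%N -> (b' <= b)%N -> section_of a' b' (between A a' b').
Proof.
move=> [AV cardA] aa' b'b; split=> [|j].
  exact: fintype.subset_trans (between_sub _ _ _) AV.
have [jb|jb] := boolP (a' <= j < b')%N.
  have := cardA j; have -> : (a <= j < b)%N by lia.
  move=> <-; apply: eq_card => i; rewrite !inE.
  by case: eqP => [->|]; rewrite ?andbF ?jb ?andbT.
apply/eqP; rewrite cards_eq0; apply/eqP/setP => i; rewrite !inE.
by case: eqP => [->|]; rewrite ?andbF // (negPf jb) andbF.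
Qed.

(** Outside [[a, b)] the count in [section_of] is zero. *)
Lemma section_tag a b A i : section_of a b A -> i \in A -> (a <= tag i < b)%N.
Proof.
move=> [_ /(_ (tag i))] + iA; case: (a <= _ < b)%N => // /eqP.
by rewrite cards_eq0 => /eqP/setP/(_ i); rewrite !inE iA eqxx.
Qed.

(** As [[a, b)] and [[b, c)] are disjoint, the counts in each tree add up without overlap. *)
Lemma section_cat a b c A C : (a <= b <= c)%N ->
  section_of a b A -> section_of b c C -> section_of a c (A :|: C).
Proof.
move=> abc sA sC; split=> [|j]; first by rewrite finset.subUset sA.1 sC.1.
have -> : [set i in A :|: C | tag i == j]%SET =
          [set i in A | tag i == j]%SET :|: [set i in C | tag i == j]%SET.
  by apply/setP => i; rewrite !inE andb_orl.
rewrite cardsU disjoint_setI0 ?cards0 ?sA.2 ?sC.2; first by lia.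
rewrite -setI_eq0; apply/eqP/setP => i; rewrite !inE; apply/negP.
move=> /andP[/andP[/(section_tag sA) iA _] /andP[/(section_tag sC) iC _]].
by lia.
Qed.

(** * Soundness and completeness of merging *)

Definition enumerates (a b : nat) U := forall A (B : set 'rV[R]_d),
  (A, B) \in U <-> [/\ section_of a b A, B = common_box A & common_box A !=set0].

(** Concatenating sections gives soundness. For completeness a section is cut at tree [b]; both
    halves inherit a common point, so the pair passes the nonemptiness test. *)
Lemma enumerates_merge a b c U U' : (a <= b <= c)%N ->
  enumerates a b U -> enumerates b c U' -> enumerates a c (merge_parts U U').
Proof.
move=> abc eU eU' A B; split.
- case/imfset2P => /= -[A1 B1] U1 [[A2 B2]]; rewrite inE /= => /andP[U2 meet].
  have [s1 B1E _] := (eU _ _).1 U1; have [s2 B2E _] := (eU' _ _).1 U2.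
  case=> -> ->; rewrite common_boxU B1E B2E in meet *.
  split=> //; last by apply/set0P; rewrite meet.
  by rewrite finset.setUC; exact: section_cat s1 s2.
- case=> sA -> meetA; apply/imfset2P.
  (* The order follows [merge_parts], which puts the newly read set first in the union. *)
  have AE : A = between A b c :|: between A a b.
    rewrite finset.setUC between_cat //; apply/setP => i; rewrite inE.
    by have [iA|] := boolP (i \in A); rewrite ?(section_tag sA iA).
  have meetS a' b' : common_box (between A a' b') !=set0.
    by have [y yA] := meetA; exists y; exact: common_boxS (between_sub _ _ _) _ yA.
  exists (between A a b, common_box (between A a b)).
    by apply/eU; split=> //; apply: section_between sA _ _; lia.
  exists (between A b c, common_box (between A b c)).
    rewrite inE /= -common_boxU -AE; apply/andP; split; last exact/set0P.
    by apply/eU'; split=> //; apply: section_between sA _ _; lia.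
  by rewrite /= -common_boxU -AE.
Qed.

(** Here [f] lists the interval boundaries and [m] counts the sets already merged into [U]; the
    induction along [s] has to vary [m]. *)
Lemma enumerates_foldl (f : nat -> nat) m U (s : seq (pseudo tr)) :
    {homo f : i j / (i <= j)%N} -> enumerates (f 0) (f m) U ->
    (forall k, (k < size s)%N -> enumerates (f (m + k)%N) (f (m + k).+1) (nth fset0 s k)) ->
  enumerates (f 0) (f (m + size s)%N) (foldl (@merge_parts R d K tr) U s).
Proof.
move=> f_homo; elim: s m U => [|U' s IHs] m U eU es /=; first by rewrite addn0.
rewrite addnS -addSn; apply: IHs => [|k ks]; last first.
  by have := es k.+1 ks; rewrite /= addnS.
apply: enumerates_merge eU _; first by rewrite !f_homo.
by have := es 0%N isT; rewrite addn0.
Qed.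

Lemma enumerates_group (f : nat -> nat) (s : seq (pseudo tr)) :
    {homo f : i j / (i <= j)%N} -> (0 < size s)%N ->
    (forall k, (k < size s)%N -> enumerates (f k) (f k.+1) (nth fset0 s k)) ->
  enumerates (f 0) (f (size s)) (enum_group s).
Proof.
case: s => // U s f_homo _ es; rewrite /= -[(size s).+1]add1n.
apply: enumerates_foldl => //; first exact: (es 0%N).
by move=> k ks; have := es k.+1 ks; rewrite /= add1n.
Qed.

(** Base of the induction on the level: a section of [[k, k.+1)] is a singleton, and its box is
    nonempty because a vertex meets the ball. *)
Lemma enumerates_Vpart (k : 'I_K) :
  enumerates k k.+1 [fset ([set i]%SET, ebox i) | i in Vpart tr x eps k]%fset.
Proof.
move=> A B; split.
- case/imfsetP => i /=; rewrite inE => /andP[iV /eqP ik] [-> ->].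
  rewrite common_box1; split=> //; last first.
    by move: iV; rewrite inE => /set0P[y [yi _]]; exists y.
  split=> [|j]; first by rewrite finset.sub1set.
  have [kj|kj] := eqVneq k j.
    rewrite -kj leqnn ltnSn /= -(cards1 i); apply: eq_card => i'.
    by rewrite !inE; case: eqP => // ->; rewrite ik eqxx.
  have -> : (k <= j < k.+1)%N = false.
    by apply/negbTE/negP => /andP[? ?]; case/eqP: kj; apply: val_inj => /=; lia.
  apply/eqP; rewrite cards_eq0; apply/eqP/setP => i'; rewrite !inE.
  by case: eqP => // ->; rewrite ik (negPf kj).
- case=> sA -> _; have := sA.2 k; rewrite leqnn ltnSn => /eqP/cards1P[i Ai].
  have AE : A = [set i]%SET.
    rewrite -Ai; apply/setP => i'; rewrite inE.
    have [i'A|//] := boolP (i' \in A); have := section_tag sA i'A.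
    by rewrite ltnS -eqn_leq => /eqP e; symmetry; apply/eqP/val_inj.
  apply/imfsetP; exists i => /=; last by rewrite AE common_box1.
  have : i \in [set i]%SET by rewrite inE.
  rewrite -Ai !inE => /andP[iA ->]; rewrite andbT.
  by have := fintype.subsetP sA.1 _ iA; rewrite inE.
Qed.

(** * Intervals of trees covered by the parts of a level *)

Lemma size_level T l : (0 < T)%N -> size (level tr x eps T l) = cdivn K (T ^ l).
Proof.
move=> T_gt0; case: l => [|l] /=; rewrite size_map ?size_iota // size_enum_ord.
by rewrite /cdivn expn0 divn1 dvd1n addn0.
Qed.

(** Boundary between parts [k.-1] and [k] of level [l]; the minimum with [K] accounts for a shorter
    last part. *)
Definition cut T l k := minn K (k * T ^ l).

Lemma cut_homo T l : {homo cut T l : i j / (i <= j)%N}.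
Proof.
by move=> i j ij; rewrite /cut leq_min geq_minl /= geq_min leq_mul2r ij !orbT.
Qed.

Lemma cut0 T l : cut T l 0 = 0%N.
Proof. by rewrite /cut mul0n minn0. Qed.

Lemma cut_last T l : (0 < T)%N -> cut T l (cdivn K (T ^ l)) = K.
Proof.
move=> T_gt0; apply/minn_idPl.
have Tl_gt0 : (0 < T ^ l)%N by rewrite expn_gt0 T_gt0.
by rewrite leqNgt -ltn_cdivn // ltnn.
Qed.

Lemma enumerates_Upart T l k : (0 < T)%N -> (k < cdivn K (T ^ l))%N ->
  enumerates (cut T l k) (cut T l k.+1) (Upart tr x eps T l k).
Proof.
move=> T_gt0; elim: l k => [|l IHl] k.
  rewrite ltn_cdivn ?expn_gt0 ?T_gt0 // /cut expn0 !muln1 => kK.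
  rewrite (minn_idPr (ltnW kK)) (minn_idPr kK) /Upart /=.
  rewrite (nth_map (Ordinal kK)) ?size_enum_ord // (nth_ord_enum _ (Ordinal kK)).
  exact: enumerates_Vpart (Ordinal kK).
move=> kN; rewrite /Upart [level _ _ _ _ _]/=.
rewrite (nth_map 0%N) ?size_iota // nth_iota // add0n.
set s := take _ _.
have Tl_gt0 m : (0 < T ^ m)%N by rewrite expn_gt0 T_gt0.
have kT : (k * T < cdivn K (T ^ l))%N.
  by rewrite ltn_cdivn // -mulnA -expnS -ltn_cdivn.
have size_s : size s = minn T (cdivn K (T ^ l) - k * T).
  by rewrite size_take_min size_drop size_level.
have -> : cut T l.+1 k = cut T l (k * T + 0)%N by rewrite /cut addn0 expnS mulnA.
(* A full group ends [T] parts later; a truncated one stops at the last part of level [l], where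
   both boundaries equal [K]. *)
have -> : cut T l.+1 k.+1 = cut T l (k * T + size s)%N.
  rewrite size_s /cut expnS mulnA mulSn.
  have KN : (K <= cdivn K (T ^ l) * T ^ l)%N by rewrite leqNgt -ltn_cdivn // ltnn.
  have [TN|NT] := leqP T (cdivn K (T ^ l) - k * T).
    by rewrite addnC.
  rewrite subnKC 1?ltnW // !(minn_idPl _) //.
  by apply: leq_trans KN _; rewrite leq_mul2r; lia.
apply: (@enumerates_group (fun j => cut T l (k * T + j)%N)).
- by move=> i j ij; apply: cut_homo; rewrite leq_add2l.
- by rewrite size_s; lia.
- move=> j; rewrite size_s => js.
  rewrite addnS nth_take ?nth_drop; last by lia.
  by apply: IHl; lia.
Qed.

(** * K-cliques as choices of one vertex in every tree *)

Lemma adj_tag (i j : eleaf tr) : adj i j -> tag i != tag j.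
Proof.
case: i j => [k i] [k' j] /andP[neq_ij /set0P[y [yi yj]]] /=.
apply/eqP => kk'; subst k'; case/eqP: neq_ij; congr Tagged.
exact: leaf_box_inj yi yj.
Qed.

(** At most one vertex per tree and [K] in all means exactly one in each tree; [box_helly] turns
    pairwise intersection into a common point. *)
Lemma KcliqueP C :
  is_Kclique x eps C <-> section_of 0 K C /\ common_box C !=set0.
Proof.
have cardE : #|C| = (\sum_(j < K) #|[set i in C | tag i == j]%SET|)%N.
  rewrite -sum1_card (partition_big (fun i : eleaf tr => tag i) xpredT) //=.
  by apply: eq_bigr => j _; rewrite -sum1_card; apply: eq_bigl => i; rewrite inE.
split=> [/and3P[CV /eqP cardC /forall_inP clC]|[sC [y yC]]].
- have adjC i j : i \in C -> j \in C -> i != j -> adj i j.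
    by move=> iC jC; have /forall_inP/(_ j jC)/implyP := clC i iC.
  have card_le1 (j : 'I_K) : (#|[set i in C | tag i == j]%SET| <= 1)%N.
    apply/card_le1P => i; rewrite inE => /andP[iC /eqP ij] i'.
    rewrite !inE; apply/andP/eqP => [[i'C /eqP i'j]|->]; last by rewrite ij.
    apply/eqP/negPn/negP => /(adjC _ _ i'C iC)/adj_tag.
    by rewrite i'j ij eqxx.
  split.
    split=> // j; rewrite ltn_ord.
    (* Counts bounded by 1 whose sum is [K] must all equal 1. *)
    have : (\sum_(j < K) #|[set i in C | tag i == j]%SET| == \sum_(j < K) 1)%N.
      by rewrite -cardE cardC sum1_card card_ord.
    rewrite (leqif_sum (fun j _ => leqif_eq (card_le1 j))).
    by move=> /forallP/(_ j)/eqP.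
  (* The case [i = j] is also needed: a vertex has a nonempty box since it meets the ball. *)
  apply: box_helly => i j iC jC; have [->|ij] := eqVneq i j.
    have := fintype.subsetP CV _ jC; rewrite inE => /set0P[y [yj _]].
    by exists y.
  by have /andP[_ /set0P] := adjC i j iC jC ij.
- apply/and3P; split; first exact: sC.1.
    rewrite cardE; under eq_bigr => j _ do rewrite sC.2 ltn_ord.
    by rewrite sum1_card card_ord.
  apply/forall_inP => i iC; apply/forall_inP => j jC; apply/implyP => ij.
  by rewrite /adj ij; apply/set0P; exists y; split; exact: yC.
Qed.

(** * The two upper bounds and the case of a single part *)

Section Bounds.
Variables (T L : nat).
Hypothesis T_gt0 : (0 < T)%N.
Let N := cdivn K (T ^ L).

Section Clique.
Variable C : {set eleaf tr}.
Hypothesis clC : is_Kclique x eps C.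

Let piece k := between C (cut T L k) (cut T L k.+1).

Lemma piece_Upart k : (k < N)%N -> (piece k, common_box (piece k)) \in Upart tr x eps T L k.
Proof.
have [sC [y yC]] := (KcliqueP C).1 clC.
move=> kN; apply/(enumerates_Upart T_gt0 kN); split=> //.
  by apply: section_between sC _ _; rewrite // /cut geq_minl.
by exists y; exact: common_boxS (between_sub _ _ _) _ yC.
Qed.

Lemma piece_Vpseudo k : (k < N)%N -> piece k \in Vpseudo tr x eps T L k.
Proof.
by move=> kN; apply/imfsetP; exists (piece k, common_box (piece k)) => //; exact: piece_Upart.
Qed.

Lemma piece_padj k : (k.+1 < N)%N -> padj x eps T L k k.+1 (piece k) (piece k.+1).
Proof.
have [_ [y yC]] := (KcliqueP C).1 clC.
move=> kN; apply/asboolP; exists (common_box (piece k)), (common_box (piece k.+1)).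
split; [exact: piece_Upart (ltnW kN)|exact: piece_Upart|].
by apply/set0P; exists y; split; exact: common_boxS (between_sub _ _ _) _ yC.
Qed.

Lemma vsum_pieceS k :
  vsum (between C 0 (cut T L k.+1)) = vsum (between C 0 (cut T L k)) + vsum (piece k).
Proof. by apply: vsum_between; rewrite leq0n cut_homo. Qed.

Lemma vsum_between0 : vsum (between C 0 0) = 0.
Proof.
by rewrite /vsum big_pred0 // => i; rewrite inE /= ltn0 andbF.
Qed.

Lemma vsum_le_bound_sum : ((vsum C)%:E <= bound_sum tr x eps T L)%E.
Proof.
have -> : (vsum C)%:E = (\sum_(k < N) (vsum (piece k))%:E)%E.
  (* Writing [K] as [cut T L N] lets an induction on the number of parts peel off one piece at a
     time. *)
  rewrite -[in LHS](betweenT C) -[X in between C 0 X](cut_last L T_gt0) -/N.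
  elim: N => [|n IHn]; first by rewrite big_ord0 cut0 vsum_between0.
  by rewrite big_ord_recr /= -IHn vsum_pieceS EFinD.
apply: lee_sum => k _; apply: le_bigmax_seq => //.
exact: piece_Vpseudo.
Qed.

(** The pieces of [C] form a path of adjacent pseudo nodes, so each piece is a candidate in the
    maximum defining [dval] at the next one. *)
Lemma vsum_le_dval k : (k < N)%N ->
  ((vsum (between C 0 (cut T L k.+1)))%:E <= dval x eps T L k (piece k))%E.
Proof.
elim: k => [|k IHk] kN; rewrite vsum_pieceS /=.
  by rewrite cut0 vsum_between0 add0r.
rewrite addrC EFinD leeD2l //; apply: (le_trans (IHk (ltnW kN))).
apply: le_bigmax_seq; first exact: piece_Vpseudo (ltnW kN).
exact: piece_padj.
Qed.

Lemma vsum_le_bound_dp : (0 < K)%N -> ((vsum C)%:E <= bound_dp tr x eps T L)%E.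
Proof.
(* Since [N] is positive, [N.-1] is a genuine last part, with right boundary [K]. *)
move=> K_gt0; have N_gt0 : (0 < N)%N by rewrite ltn_cdivn // expn_gt0 T_gt0.
have := @vsum_le_dval N.-1; rewrite prednK // cut_last // betweenT leqnn.
move=> /(_ isT)/le_trans; apply; apply: le_bigmax_seq => //.
by apply: piece_Vpseudo; rewrite prednK.
Qed.

End Clique.

Lemma Vpseudo_Kclique A : N = 1%N -> A \in Vpseudo tr x eps T L 0 -> is_Kclique x eps A.
Proof.
move=> N1 /imfsetP[[A' B] /= AB ->].
have N_gt0 : (0 < cdivn K (T ^ L))%N by rewrite -/N N1.
have [sA _ meetA] := (enumerates_Upart T_gt0 N_gt0 _ _).1 AB.
apply/KcliqueP; split=> //; move: sA.
by rewrite cut0 -[in cut _ _ 1]N1 cut_last.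
Qed.

(** With one part both bounds reduce to this maximum, so this is the converse inequality for
    both. *)
Lemma bigmax_Vpseudo_le_vstar : N = 1%N ->
  (\big[maxe/-oo]_(A <- Vpseudo tr x eps T L 0) (vsum A)%:E <= vstar tr x eps)%E.
Proof.
move=> N1; rewrite big_seq; apply: bigmax_le => [|A AV]; first exact: leNye.
by apply: le_bigmax_cond; exact: Vpseudo_Kclique.
Qed.

End Bounds.
End Ensemble.

Theorem mainTheorem4 (R : realType) (d K : nat) (tr : ensemble R d K)
    (x : 'rV[R]_d) (eps : R) (T L : nat)
    (K_gt0 : (0 < K)%N) (eps_ge0 : (0 <= eps)%R)
    (T_ge2 : (2 <= T)%N) (L_le : (L <= up_log T K)%N) :
  [/\ (vstar tr x eps <= bound_sum tr x eps T L)%E,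
      (vstar tr x eps <= bound_dp tr x eps T L)%E &
      cdivn K (T ^ L)%N = 1%N ->
        bound_sum tr x eps T L = vstar tr x eps /\
        bound_dp tr x eps T L = vstar tr x eps].
Proof.
have T_gt0 : (0 < T)%N := ltnW T_ge2.
have le_sum : (vstar tr x eps <= bound_sum tr x eps T L)%E.
  apply: bigmax_le => [|C]; [exact: leNye|exact: vsum_le_bound_sum].
have le_dp : (vstar tr x eps <= bound_dp tr x eps T L)%E.
  by apply: bigmax_le => [|C clC]; [exact: leNye|exact: vsum_le_bound_dp].
split=> // N1; have le_vstar := bigmax_Vpseudo_le_vstar tr x eps T_gt0 N1.
split; apply/eqP; rewrite eq_le ?le_sum ?le_dp andbT.
  by rewrite /bound_sum N1 big_ord1.
by rewrite /bound_dp N1.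
Qed.
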